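(* Let $(\mathcal{M},g)$ be a $C^\infty$ pseudo-Riemannian manifold of dimension $n$ and signature $(q,n-q)$, and fix a non-negative integer $k$. Assume that the algebraic structure of the curvature tensors does not change over the neighbourhood under consideration. Let $p\in\mathcal{M}$ be a point of this neighbourhood. For an orthonormal frame $\omega=\{\mathbf{e}_1,\dots,\mathbf{e}_n\}$ at $p$, let $X_\omega=[R_{abcd},R_{abcd;e},\dots,R_{abcd;e_1\dots e_k}]\in\mathbb{R}^m$ be the tuple of frame components of the Riemann tensor and its covariant derivatives up to order $k$ at $p$. Then either: (1) $X_\omega$ is characterised by its invariants; or (2) for every $\epsilon>0$ there exist an orthonormal frame $\omega$ at $p$ and a vector $\tilde{X}_\omega\in\mathbb{R}^m$ such that $X_\omega=\tilde{X}_\omega+N_\omega$ with $\|N_\omega\|<\epsilon$, where $\tilde{X}_\omega$ is characterised by its invariants, and every polynomial invariant takes the same value on $\tilde{X}_\omega$ as on $X_\omega$.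
   Context: The group $G=O(q,n-q)$ acts on orthonormal frames at $p$: for $g=(M^a_{~b})$, $g\omega=\{M^a_{~1}\mathbf{e}_a,\dots,M^a_{~n}\mathbf{e}_a\}$. This induces a linear action on $\mathbb{R}^m$ through the tensor structure of the components: each tensor component block $R^{(i)}_{a_1\dots a_{k_i}}$ is mapped to $M^{b_1}_{~a_1}\cdots M^{b_{k_i}}_{~a_{k_i}}R^{(i)}_{b_1\dots b_{k_i}}$, so that $X_{g\omega}=g(X_\omega)$. (The components in $X_\omega$ need not be independent; their order is irrelevant.) The orbit of $X\in\mathbb{R}^m$ is $\mathcal{O}(X)=\{g(X): g\in G\}$. A vector $X\in\mathbb{R}^m$ is said to be \emph{characterised by its invariants} if its orbit $\mathcal{O}(X)$ is topologically closed in $\mathbb{R}^m$ (equivalently, its orbit under the complexified group $O(n,\mathbb{C})$ acting on $\mathbb{C}^m$ is closed). A polynomial invariant is a polynomial function $I:\mathbb{R}^m\to\mathbb{R}$ with $I(g(X))=I(X)$ for all $g\in G$. $\|\cdot\|$ denotes the standard Euclidean norm on $\mathbb{R}^m$ (which is $O(q)\times O(n-q)$-invariant). *)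

(* Defs.v *)
From HB Require Import structures.
From mathcomp Require Import all_boot all_order all_algebra.
From mathcomp Require Import reals.
Set Implicit Arguments. Unset Strict Implicit. Unset Printing Implicit Defensive.
Import Order.TTheory GRing.Theory Num.Theory.
Local Open Scope ring_scope.

Section CurvatureOrbits.
Variables (R : realType) (n q k : nat).

(* Index set of the components of X_omega = [R_{abcd}, R_{abcd;e}, ...,
   R_{abcd;e_1...e_k}]: block i (0 <= i <= k) is a tensor of rank 4 + i,
   whose components are indexed by (4+i)-tuples of frame indices in 'I_n. *)
Definition comp_index := {i : 'I_k.+1 & (4 + val i).-tuple 'I_n}.

Definition compvec := {ffun comp_index -> R}.

Definition cnorm (X : compvec) : R := Num.sqrt (\sum_x (X x) ^+ 2).

Definition eta : 'M[R]_n := \matrix_(a, b) (if a == b then (if (val a < q)%N then -1 else 1) else 0).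

(* G = O(q, n-q): matrices M = (M^a_b) (row a, column b) with M^T eta M = eta,
   i.e. exactly those sending an orthonormal frame to an orthonormal frame. *)
Definition in_G (M : 'M[R]_n) : Prop := M^T *m eta *m M = eta.

Definition act (M : 'M[R]_n) (X : compvec) : compvec :=
  [ffun x => \sum_(b : (4 + val (tag x)).-tuple 'I_n)
      (\prod_(j < 4 + val (tag x)) M (tnth b j) (tnth (tagged x) j))
      * X (Tagged (fun i : 'I_k.+1 => (4 + val i).-tuple 'I_n) b)].

Definition in_orbit_closure (X Y : compvec) : Prop :=
  forall e : R, 0 < e -> exists M, in_G M /\ cnorm (act M X - Y) < e.

(* X is characterised by its invariants: its orbit O(X) = {g(X) : g in G}
   is topologically closed in R^m. *)
Definition characterised (X : compvec) : Prop :=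
  forall Y, in_orbit_closure X Y -> exists M, in_G M /\ act M X = Y.

Inductive poly_fun : (compvec -> R) -> Prop :=
| pf_const (c : R) : poly_fun (fun _ => c)
| pf_coord (x : comp_index) : poly_fun (fun X => X x)
| pf_add f g : poly_fun f -> poly_fun g -> poly_fun (fun X => f X + g X)
| pf_mul f g : poly_fun f -> poly_fun g -> poly_fun (fun X => f X * g X).

Definition poly_invariant (I : compvec -> R) : Prop :=
  poly_fun I /\ forall M X, in_G M -> I (act M X) = I X.

End CurvatureOrbits.

(* Main.v *)
Require Import Defs.
From HB Require Import structures.
From mathcomp Require Import all_boot all_order all_algebra.
From mathcomp Require Import complex ordered_qelim qe_rcf.
From mathcomp Require Import all_classical all_reals all_analysis.
From mathcomp Require Import ring lra.
Set Implicit Arguments. Unset Strict Implicit. Unset Printing Implicit Defensive.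
Import Order.TTheory GRing.Theory Num.Theory.
Import numFieldNormedType.Exports.
Local Open Scope ring_scope.
Local Open Scope classical_set_scope.

(* The closure of the orbit of X0 contains a vector Y of minimal norm, and Y has
   the norm property |g Y| >= |Y| for all g in G.  Polynomial invariants agree
   on X0 and Y by continuity, so it suffices that such a minimal vector has a
   closed orbit (half of the Kempf-Ness theorem).

   Let g_j Y -> Z and write g_j = P_j D_j Q_j with P_j, Q_j orthogonal and D_j
   positive diagonal.  Along an ultrafilter P_j -> P and Q_j -> Q.  In the
   coordinates of R^m the matrix D_j acts diagonally by monomial weights, and
   minimality of Y, tested on the elements P_j D_j^t P_j^-1 of G for small t,
   shows that no weight at a nonzero component of the limit vector tends to 0.
   Hence Q^-1 D_j^-1 P^-1, which lies in G for large j, sends Z to vectors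
   converging to Y: every orbit in the closure of G Y accumulates at Y.

   On the other hand G Y is semialgebraic by quantifier elimination, hence
   contains a nonempty relatively open subset of its closure; translating by G,
   it is relatively open in its closure.  So the orbit of Z meets G Y. *)

(** * Orthogonal diagonalisation of real symmetric matrices *)

(** Over the complexification [A] is Hermitian, so its spectral decomposition has real diagonal
    entries; such an entry is a root of the characteristic polynomial already over [R]. *)
Lemma symmetric_eigenvalue (R : rcfType) n (A : 'M[R]_n.+1) :
  A^T = A -> exists a, eigenvalue A a.
Proof.
move=> Asym; pose Ac := map_mx (real_complex R) A.
have Areal : Ac \is a realmx.
  by apply/mxOverP => i j; rewrite mxE complex_real.
have Aherm : Ac \is hermsymmx.
  apply: realsym_hermsym => //; apply/is_hermitianmxP.
  rewrite expr0 scale1r (map_mx_id_in (M := Ac^T)) //.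
  by rewrite /Ac map_trmx Asym.
have /orthomx_spectralP := hermitian_normalmx Aherm.
have := hermitian_spectral_diag_real Aherm.
have := spectral_unit Ac.
move: (spectralmx Ac) (spectral_diag Ac) => P D Pu Dreal AE.
have [a aE] : exists a : R, D 0 0 = real_complex R a.
  have /mxOverP/(_ 0 0) Dr := Dreal.
  by exists (complex.Re (D 0 0)); apply/esym/RRe_real.
exists a; rewrite eigenvalue_root_char.
rewrite -(fmorph_root (real_complex R)) map_char_poly -eigenvalue_root_char -/Ac.
apply/eigenvalueP; exists (row 0 P).
  rewrite -row_mul {1}AE -mulmxA mulKVmx //.
  by rewrite row_mul row_diag_mx aE -scalemxAl -rowE.
by rewrite rowE mulmx_free_eq0 ?row_free_unit // -mxrank_eq0 mxrank_delta.
Qed.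

Lemma mulmx_tr_gt0 (R : realDomainType) n (v : 'rV[R]_n) :
  v != 0 -> 0 < (v *m v^T) 0 0.
Proof.
move=> /matrix0Pn [i [j vij]]; rewrite mxE.
rewrite (bigD1 j) //= ltr_pwDl // ?mxE -?expr2.
  by rewrite exprn_even_gt0 //= -(ord1 i).
by apply: sumr_ge0 => k _; rewrite mxE -expr2 sqr_ge0.
Qed.

Lemma trmx11 (R : pzSemiRingType) (x : 'M[R]_1) : x^T = x.
Proof. by rewrite [x]mx11_scalar tr_scalar_mx. Qed.

(** For distinct [u] and [v], the reflection in the hyperplane orthogonal to [v - u] exchanges these
    two unit vectors. *)
Lemma householder (R : realFieldType) n (u v : 'rV[R]_n) :
  u *m u^T = 1 -> v *m v^T = 1 ->
  exists H : 'M[R]_n, [/\ H^T = H, H *m H = 1%:M & v *m H = u].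
Proof.
move=> u1 v1; have [<-|nvu] := eqVneq v u.
  by exists 1%:M; rewrite trmx1 !mulmx1.
have [w wE] : exists w, w = v - u by exists (v - u).
pose s := (w *m w^T) 0 0.
have s0 : s != 0 by rewrite gt_eqF // mulmx_tr_gt0 // wE subr_eq0.
have ww : w *m w^T = s%:M by rewrite [LHS]mx11_scalar.
have uvC : u *m v^T = v *m u^T.
  by rewrite -[LHS]trmx11 trmx_mul trmxK.
(* As [u] and [v] have the same length, the squared length of [w] is twice its inner product with
   [v]. *)
have sE : s%:M = (v *m w^T) *+ 2.
  rewrite -ww {1}wE mulmxBl wE linearB /= !mulmxBr u1 v1 uvC mulr2n.
  by rewrite opprB addrACA.
exists (1%:M - (2 / s) *: (w^T *m w)); split.
- by rewrite linearB /= linearZ /= trmx1 trmx_mul trmxK.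
- rewrite mulmxBl mul1mx mulmxBr mulmx1 -scalemxAl -scalemxAr.
  rewrite mulmxA -(mulmxA w^T) ww -mulmxA mul_scalar_mx -scalemxAr !scalerA.
  rewrite opprB addrA addrAC -(addrA 1%:M) -opprD -scalerDl.
  have -> : 2 / s * (2 / s * s) = 2 / s + 2 / s.
    by rewrite mulfVK // mulr_natr mulr2n.
  by rewrite addrNK.
- rewrite mulmxBr mulmx1 -scalemxAr mulmxA.
  have -> : v *m w^T = (s / 2)%:M.
    have /matrixP/(_ 0 0) := sE; rewrite !mxE eqxx !mulr1n mulr2n => sE00.
    by rewrite [LHS]mx11_scalar mxE sE00 -mulr2n -mulr_natr mulfK ?pnatr_eq0.
  rewrite mul_scalar_mx scalerA mulrA mulfVK // mulfV ?pnatr_eq0 //.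
  by rewrite scale1r wE opprB addrCA subrr addr0.
Qed.

(** Induction on [n]: a Householder reflection carries a unit eigenvector to the first basis vector.
    The conjugated matrix is still symmetric, so it splits off a 1 by 1 block. *)
Theorem symmetric_spectral (R : rcfType) n (A : 'M[R]_n) : A^T = A ->
  exists (P : 'M[R]_n) (d : 'rV[R]_n),
    P *m P^T = 1%:M /\ A = P *m diag_mx d *m P^T.
Proof.
elim: n A => [|n IHn] A Asym.
  by exists 1%:M, 0; split; [rewrite trmx1 mulmx1|apply/matrixP => -[]].
have [a /eigenvalueP [v vA v0]] := symmetric_eigenvalue Asym.
have s0 := mulmx_tr_gt0 v0; set s := _ 0 0 in s0.
have vv : v *m v^T = s%:M by rewrite [LHS]mx11_scalar.
pose v1 := (Num.sqrt s)^-1 *: v.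
have v11 : v1 *m v1^T = 1.
  rewrite linearZ /= -scalemxAl -scalemxAr vv scalerA scale_scalar_mx.
  by rewrite -invfM -expr2 sqr_sqrtr ?ltW // mulVf ?gt_eqF.
have v1A : v1 *m A = a *: v1 by rewrite -scalemxAl vA !scalerA mulrC.
pose e : 'rV[R]_(1 + n) := row_mx 1 0.
have e1 : e *m e^T = 1.
  by rewrite tr_row_mx mul_row_col trmx1 trmx0 mulmx0 addr0 mulmx1.
have [H [Hsym HH v1H]] := householder e1 v11.
pose B : 'M[R]_(1 + n) := H *m A *m H.
have Bsym : B^T = B by rewrite /B !trmx_mul Hsym Asym mulmxA.
have eB : e *m B = a *: e.
  by rewrite /B !mulmxA -[in LHS]v1H -(mulmxA v1) HH mulmx1 v1A -scalemxAl v1H.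
have BE : B = block_mx a%:M 0 0 (drsubmx B).
  have Bu : usubmx B = a *: e.
    rewrite -eB -[in RHS](vsubmxK B) mul_row_col mul0mx addr0.
    by rewrite mul1mx.
  have ul : ulsubmx B = a%:M by rewrite /ulsubmx Bu linearZ /= row_mxKl scalemx1.
  have ur : ursubmx B = 0 by rewrite /ursubmx Bu linearZ /= row_mxKr scaler0.
  have dl : dlsubmx B = 0 by rewrite -[B]Bsym -trmx_ursub ur trmx0.
  by rewrite -{1}[B]submxK ul ur dl.
have [|P' [d' [P'1 B'E]]] := IHn (drsubmx B); first by rewrite trmx_drsub Bsym.
pose Q : 'M[R]_(1 + n) := block_mx 1%:M 0 0 P'.
pose d : 'rV[R]_(1 + n) := row_mx a%:M d'.
have QQ : Q *m Q^T = 1%:M.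
  rewrite /Q tr_block_mx mulmx_block trmx1 !trmx0 !mulmx0 !mul0mx !addr0 !add0r.
  by rewrite mulmx1 P'1 -scalar_mx_block.
have QdQ : Q *m diag_mx d *m Q^T = B.
  rewrite /Q tr_block_mx diag_mx_row !mulmx_block trmx1 !trmx0.
  rewrite !mulmx0 !mul0mx !addr0 !add0r !mulmx1 mul1mx -B'E [in RHS]BE.
  congr block_mx; rewrite ?mul0mx //.
  by rewrite [LHS]mx11_scalar !mxE eqxx mulr1n.
exists (H *m Q), d; split; first by rewrite trmx_mul Hsym mulmxA -(mulmxA H) QQ mulmx1.
rewrite trmx_mul Hsym !mulmxA -(mulmxA H) -(mulmxA H) QdQ /B !mulmxA HH mul1mx.
by rewrite -mulmxA HH mulmx1.
Qed.

(** * The action on component vectors *)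

Lemma bigA_distr_tuple (R : comPzSemiRingType) (I : finType) m
    (F : 'I_m -> I -> R) :
  \prod_(j < m) \sum_(i : I) F j i =
  \sum_(b : m.-tuple I) \prod_(j < m) F j (tnth b j).
Proof.
rewrite bigA_distr_bigA /=.
rewrite (reindex (fun b : m.-tuple I => [ffun j => tnth b j])) /=; last first.
  exists (fun f : {ffun 'I_m -> I} => [tuple f j | j < m]) => [b _|f _].
    by apply: eq_from_tnth => j; rewrite tnth_mktuple ffunE.
  by apply/ffunP => j; rewrite ffunE tnth_mktuple.
by apply: eq_bigr => b _; apply: eq_bigr => j _; rewrite ffunE.
Qed.

Lemma sum_tagged (V : nmodType) (I : finType) (J : I -> finType)
    (G : {i : I & J i} -> V) :
  \sum_x G x = \sum_i \sum_(t : J i) G (Tagged J t).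
Proof.
rewrite (sig_big_dep xpredT (fun _ => xpredT) (fun i t => G (Tagged J t))) /=.
by apply: eq_bigr => -[].
Qed.

Section Action.
Variables (R : realType) (n q k : nat).
Implicit Types (A B M : 'M[R]_n) (X Y : compvec R n k).

(** The action contracts the row index of the matrix, so composition reverses products: in
    [act (P *m D *m Q)] the factor [P] acts first. *)
Lemma act_mul A B X : act A (act B X) = act (B *m A) X.
Proof.
apply/ffunP => x; rewrite !ffunE /=.
under eq_bigr => b _ do rewrite ffunE /= mulr_sumr.
rewrite exchange_big; apply: eq_bigr => c _ /=.
under eq_bigr => b _ do rewrite mulrA.
rewrite -mulr_suml; congr (_ * _).
under [RHS]eq_bigr => j _ do rewrite mxE.
rewrite bigA_distr_tuple; apply: eq_bigr => b _.
by rewrite -big_split; apply: eq_bigr => j _ /=; rewrite mulrC.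
Qed.

Definition weight (d : 'rV[R]_n) (x : comp_index n k) : R :=
  \prod_(j < 4 + val (tag x)) d 0 (tnth (tagged x) j).

Lemma act_diag (d : 'rV[R]_n) X x : act (diag_mx d) X x = weight d x * X x.
Proof.
rewrite ffunE (bigD1 (tagged x)) //= [X in _ + X]big1 ?addr0 => [|b bx].
  rewrite /weight; congr (_ * _); last by case: x.
  by apply: eq_bigr => j _; rewrite mxE eqxx mulr1n.
have [j bj] : exists j, tnth b j != tnth (tagged x) j.
  apply/existsP; apply: contraR bx => /existsPn bx.
  by apply/eqP/eq_from_tnth => j; apply/eqP/negPn/bx.
by rewrite (bigD1 j) //= mxE (negPf bj) mulr0n !mul0r.
Qed.

Lemma weight_gt0 (d : 'rV[R]_n) x : (forall i, 0 < d 0 i) -> 0 < weight d x.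
Proof. by move=> d0; apply: prodr_gt0. Qed.

Lemma act1 X : act 1%:M X = X.
Proof.
apply/ffunP => x; rewrite -diag_const_mx act_diag /weight.
by rewrite big1 ?mul1r // => j _; rewrite mxE.
Qed.

Definition dot X Y : R := \sum_x X x * Y x.

(** Taking adjoints commutes with tensor powers; consequently orthogonal matrices act by isometries
    on component vectors. *)
Lemma dot_act A X Y : dot (act A X) Y = dot X (act A^T Y).
Proof.
rewrite /dot.
have E (G : comp_index n k -> R) : \sum_x G x =
    \sum_(i < k.+1) \sum_(t : (4 + val i).-tuple 'I_n)
      G (Tagged (fun i : 'I_k.+1 => (4 + val i).-tuple 'I_n) t).
  exact: (sum_tagged G).
rewrite !E; apply: eq_bigr => i _.
under eq_bigr => t _ do rewrite ffunE /= mulr_suml.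
rewrite exchange_big; apply: eq_bigr => t _ /=.
rewrite ffunE /= mulr_sumr; apply: eq_bigr => b _.
rewrite mulrAC [RHS]mulrC; congr (_ * _ * _).
by apply: eq_bigr => j _; rewrite mxE.
Qed.

Definition sqnorm X : R := \sum_x X x ^+ 2.

Lemma in_G1 : in_G q (1%:M : 'M[R]_n).
Proof. by rewrite /in_G trmx1 mul1mx mulmx1. Qed.

Lemma in_GM A B : in_G q A -> in_G q B -> in_G q (A *m B).
Proof.
rewrite /in_G trmx_mul => GA GB.
by rewrite -[RHS]GB -[in RHS]GA !mulmxA.
Qed.

Lemma tr_eta : (Defs.eta R n q)^T = Defs.eta R n q.
Proof. by apply/matrixP => i j; rewrite !mxE eq_sym; case: eqP => // ->. Qed.

Lemma eta_eta : Defs.eta R n q *m Defs.eta R n q = 1%:M.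
Proof.
apply/matrixP => i j; rewrite !mxE (bigD1 i) //= big1 => [|l li]; last first.
  by rewrite !mxE eq_sym (negPf li) mul0r.
rewrite !mxE eqxx addr0; case: eqP => [->|_]; last by rewrite mulr0.
by case: ifP; rewrite ?mulrNN mulr1.
Qed.

Lemma in_G_inv A : in_G q A -> Defs.eta R n q *m A^T *m Defs.eta R n q *m A = 1%:M.
Proof. by move=> GA; rewrite -!mulmxA (mulmxA A^T) GA eta_eta. Qed.

(** The left inverse of [A] given by [in_G_inv] is also a right inverse. *)
Lemma in_G_tr A : in_G q A -> in_G q A^T.
Proof.
move=> /in_G_inv /mulmx1C AE; rewrite /in_G trmxK.
by rewrite -[LHS]mulmx1 -eta_eta [LHS]mulmxA -(mulmxA A) -(mulmxA A) AE mul1mx.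
Qed.

Lemma in_G_invmx A B : in_G q A -> B *m A = 1%:M -> in_G q B.
Proof.
move=> GA BA.
have -> : B = Defs.eta R n q *m A^T *m Defs.eta R n q.
  by rewrite -[LHS]mulmx1 -(mulmx1C (in_G_inv GA)) mulmxA BA mul1mx.
have Geta : in_G q (Defs.eta R n q) by rewrite /in_G tr_eta eta_eta mul1mx.
by do 2![apply: in_GM => //]; apply: in_G_tr.
Qed.
End Action.

(** * Polar decomposition in O(q, n-q) *)

Section Polar.
Variables (R : realType) (n q k : nat).
Implicit Types (A B M : 'M[R]_n) (X Y : compvec R n k).
Local Notation eta := (Defs.eta R n q).

Lemma sqnormE X : sqnorm X = dot X X.
Proof. by apply: eq_bigr => x _; rewrite expr2. Qed.

Lemma sqnorm_act A X : A *m A^T = 1%:M -> sqnorm (act A X) = sqnorm X.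
Proof. by move=> AA; rewrite !sqnormE dot_act act_mul AA act1. Qed.

Lemma diag_conj_entry (d e : 'rV[R]_n) A i j :
  (diag_mx d *m A *m diag_mx e) i j = d 0 i * A i j * e 0 j.
Proof. by rewrite mul_mx_diag mul_diag_mx !mxE. Qed.

(** In the basis given by [P] the form is [P^T *m eta *m P], and a diagonal matrix preserves it
    entry by entry. For positive [d] the condition passes to all real powers of [d], which yields
    one-parameter subgroups of G. *)
Lemma in_G_conj_diag (P : 'M[R]_n) (d : 'rV[R]_n) : P *m P^T = 1%:M ->
  (forall i j, (P^T *m eta *m P) i j != 0 -> d 0 i * d 0 j = 1) ->
  in_G q (P *m diag_mx d *m P^T).
Proof.
move=> PP dP; rewrite /in_G !trmx_mul trmxK tr_diag_mx.
have dE : diag_mx d *m (P^T *m eta *m P) *m diag_mx d = P^T *m eta *m P.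
  apply/matrixP => i j; rewrite diag_conj_entry mulrAC.
  have [->|/dP ->] := eqVneq ((P^T *m eta *m P) i j) 0; first by rewrite mulr0.
  by rewrite mul1r.
transitivity (P *m (diag_mx d *m (P^T *m eta *m P) *m diag_mx d) *m P^T).
  by rewrite !mulmxA.
by rewrite dE -!mulmxA PP mulmx1 !mulmxA PP mul1mx.
Qed.

(** [P] diagonalises the positive definite matrix [M *m M^T], [d] consists of the square roots of
    its eigenvalues, and [Q] is what remains of [M]. Since [M *m M^T] is in G, the last condition
    holds for the squares of the [d 0 i], hence for these positive numbers themselves. *)
Lemma in_G_svd M : in_G q M -> exists (P Q : 'M[R]_n) (d : 'rV[R]_n),
  [/\ P *m P^T = 1%:M, Q *m Q^T = 1%:M, forall i, 0 < d 0 i,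
      M = P *m diag_mx d *m Q &
      forall i j, (P^T *m eta *m P) i j != 0 -> d 0 i * d 0 j = 1].
Proof.
move=> GM; have [|P [e [PP SE]]] := @symmetric_spectral R n (M *m M^T).
  by rewrite trmx_mul trmxK.
have PP' := mulmx1C PP.
have eE : diag_mx e = P^T *m M *m (P^T *m M)^T.
  rewrite trmx_mul trmxK !mulmxA -(mulmxA P^T M) SE !mulmxA PP' mul1mx.
  by rewrite -mulmxA PP' mulmx1.
have PMu : P^T *m M \in unitmx.
  have [_ Mu] := mulmx1_unit (in_G_inv GM).
  have [Pu _] := mulmx1_unit PP'.
  by rewrite unitmx_mul Pu.
(* Each eigenvalue is the squared length of a row of the invertible matrix [P^T *m M]. *)
have e0 i : 0 < e 0 i.
  have -> : e 0 i = diag_mx e i i by rewrite mxE eqxx mulr1n.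
  have -> : diag_mx e i i = (row i (P^T *m M) *m (row i (P^T *m M))^T) 0 0.
    by rewrite eE !mxE; apply: eq_bigr => j _; rewrite !mxE.
  apply: mulmx_tr_gt0.
  by rewrite rowE mulmx_free_eq0 ?row_free_unit // -mxrank_eq0 mxrank_delta.
pose d : 'rV[R]_n := \row_i Num.sqrt (e 0 i).
have d0 i : 0 < d 0 i by rewrite mxE sqrtr_gt0.
pose d' : 'rV[R]_n := \row_i (d 0 i)^-1.
have d'd : diag_mx d' *m diag_mx d = 1%:M.
  apply/matrixP => i j; rewrite mul_mx_diag !mxE; case: eqP => [->|_].
    by rewrite !mulr1n mulVf // gt_eqF // sqrtr_gt0.
  by rewrite !mulr0n mul0r.
have dd : diag_mx d *m diag_mx d = diag_mx e.
  apply/matrixP => i j; rewrite mul_mx_diag !mxE; case: eqP => [->|_].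
    by rewrite !mulr1n -expr2 sqr_sqrtr // ltW.
  by rewrite !mulr0n mul0r.
exists P, (diag_mx d' *m (P^T *m M)), d; split => //.
- rewrite trmx_mul mulmxA -(mulmxA (diag_mx d')) -eE tr_diag_mx -dd.
  by rewrite mulmxA d'd mul1mx -(mulmx1C d'd).
- by rewrite !mulmxA -(mulmxA P) (mulmx1C d'd) mulmx1 PP mul1mx.
move=> i j Pij.
have GS : in_G q (M *m M^T) by apply: in_GM => //; apply: in_G_tr.
have /matrixP/(_ i j) : diag_mx e *m (P^T *m eta *m P) *m diag_mx e = P^T *m eta *m P.
  rewrite -[in RHS]GS SE !trmx_mul trmxK tr_diag_mx !mulmxA PP' mul1mx.
  by rewrite -!(mulmxA _ P^T P) PP' !mulmx1.
rewrite diag_conj_entry mulrAC -[RHS]mul1r => /(mulIf Pij) ee.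
apply/eqP; rewrite -(@eqrXn2 _ 2) ?mulr_ge0 ?ltW // expr1n exprMn.
by rewrite !mxE !sqr_sqrtr ?ltW // ee.
Qed.
End Polar.

(** * Limits of diagonal scalings *)

Lemma cvg_fsum (R : realType) (T : Type) (F : set_system T) {FF : Filter F}
    (I : finType) (P : pred I) (f : I -> T -> R) (l : I -> R) :
  (forall i, P i -> f i t @[t --> F] --> l i) ->
  (\sum_(i | P i) f i t) @[t --> F] --> \sum_(i | P i) l i.
Proof. by move=> fl; apply: cvg_big fl; apply: add_continuous. Qed.

Lemma cvg_fprod (R : realType) (T : Type) (F : set_system T) {FF : Filter F}
    (I : finType) (P : pred I) (f : I -> T -> R) (l : I -> R) :
  (forall i, P i -> f i t @[t --> F] --> l i) ->
  (\prod_(i | P i) f i t) @[t --> F] --> \prod_(i | P i) l i.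
Proof. by move=> fl; apply: cvg_big fl; apply: mul_continuous. Qed.

Lemma cvg_mul (R : realType) (T : Type) (F : set_system T) {FF : Filter F}
    (f g : T -> R) (a b : R) :
  f t @[t --> F] --> a -> g t @[t --> F] --> b ->
  (f t * g t) @[t --> F] --> a * b.
Proof. exact: cvgM. Qed.

Lemma cvg_sub (R : realType) (T : Type) (F : set_system T) {FF : Filter F}
    (f g : T -> R) (a b : R) :
  f t @[t --> F] --> a -> g t @[t --> F] --> b ->
  (f t - g t) @[t --> F] --> a - b.
Proof. exact: cvgB. Qed.

Lemma cvg_inv (R : realType) (T : Type) (F : set_system T) {FF : Filter F}
    (f : T -> R) (a : R) : a != 0 ->
  f t @[t --> F] --> a -> (f t)^-1 @[t --> F] --> a^-1.
Proof. exact: cvgV. Qed.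

(** By compactness of the interval there is a cluster point, and an ultrafilter converges to each of
    its cluster points. *)
Lemma ultra_bounded_cvg (R : realType) (T : Type) (F : set_system T)
    (f : T -> R) (C : R) : UltraFilter F ->
  (\forall t \near F, `|f t| <= C) -> exists l : R, f t @[t --> F] --> l.
Proof.
move=> FU fC.
have : (f @ F) `[- C, C].
  by near=> t; rewrite /= in_itv /= -ler_norml; near: t.
move=> /(@segment_compact R (- C) C (f @ F) _)[l [_ lF]]; exists l => A Al.
have [//|FnA] := in_ultra_setVsetC (f @^-1` A) FU.
have [z [fz Az]] := lF (~` A) A FnA Al.
by case: fz.
Unshelve. all: by end_near. Qed.

Lemma bernoulli_ineq (R : realDomainType) (d : R) N :
  0 <= d -> 1 + N%:R * d <= (1 + d) ^+ N.
Proof.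
move=> d0; elim: N => [|N IH]; first by rewrite mul0r addr0 expr0.
rewrite exprS; apply: le_trans (ler_wpM2l _ IH); last by lra.
rewrite -natr1; have : 0 <= N%:R * d * d by rewrite !mulr_ge0.
by nra.
Qed.

(* Here s is the root of order m+1 of w.  For m large, the terms of the last sum
   whose weight stays bounded exceed u^2 by at most a small factor, whereas a
   weight tending to 0 makes its term lose at least u^2 / 2. *)
Lemma scaling_limit_neq0 (R : realType) (T : Type) (F : set_system T)
    {FF : ProperFilter F} (I : finType) (w u : I -> T -> R) (y z : I -> R) :
  (forall x t, 0 < w x t) ->
  (forall x, u x t @[t --> F] --> y x) ->
  (forall x, w x t * u x t @[t --> F] --> z x) ->
  (forall m, exists2 s : I -> T -> R,
     forall x t, 0 <= s x t /\ s x t ^+ m.+1 = w x t &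
     \forall t \near F, \sum_x u x t ^+ 2 <= \sum_x s x t * u x t ^+ 2) ->
  forall x, y x != 0 -> z x != 0.
Proof.
move=> w0 uy wuz hmin x0 yx0; apply/negP => /eqP zx0.
have wl x : y x != 0 -> w x t @[t --> F] --> z x / y x.
  move=> yx.
  have nu : \forall t \near F, u x t != 0 by exact: (cvgr_neq0 _ (uy x) yx).
  apply: (cvg_trans (near_eq_cvg _) (cvg_mul (wuz x) (cvg_inv yx (uy x)))).
  by near=> t; rewrite mulfK //; near: t.
pose S := \sum_x y x ^+ 2.
have Sy : y x0 ^+ 2 <= S.
  by rewrite /S (bigD1 x0) //= lerDl; apply: sumr_ge0 => x _; exact: sqr_ge0.
have y20 : 0 < y x0 ^+ 2 by rewrite exprn_even_gt0.
have S0 : 0 < S by exact: lt_le_trans Sy.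
(* With this [d] the total gain [d * S] is a quarter of [y x0 ^+ 2], less than the loss of one half
   at [x0]. [C] eventually bounds the weights where [y] is nonzero, and [m] is chosen so that their
   roots are at most [1 + d]. *)
pose d := y x0 ^+ 2 / (4 * S).
have d0 : 0 < d by rewrite divr_gt0 // mulr_gt0.
pose C := 1 + \sum_x `|z x / y x|.
have C0 : 0 <= C by rewrite addr_ge0 // sumr_ge0.
have zC x : z x / y x < C.
  rewrite /C (bigD1 x) //= (le_lt_trans (ler_norm _)) //.
  by rewrite addrCA ltrDl ltr_pwDl // sumr_ge0.
have [m Cm] : exists m : nat, C <= (1 + d) ^+ m.+1.
  exists (Num.trunc (C / d)).
  apply: le_trans (bernoulli_ineq _ (ltW d0)).
  have := truncnS_gt (C / d); rewrite ltr_pdivrMr // => ?.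
  by rewrite ler_wpDl // ltW.
have [s sw smin] := hmin m.
(* Eventually [g] is a lower bound of [(1 - s) * u ^+ 2], from [s <= 1/2] at [x0], [s <= 1 + w]
   where [y] vanishes, and [s <= 1 + d] elsewhere. In the second case [w] may be unbounded, but
   [w * u] converges and [u] tends to 0. *)
pose g x t : R := if x == x0 then 2^-1 * u x t ^+ 2 else
  if y x == 0 then - (w x t * u x t) * u x t else - d * u x t ^+ 2.
pose l x : R := if x == x0 then 2^-1 * y x ^+ 2 else - d * y x ^+ 2.
have u2 x : u x t ^+ 2 @[t --> F] --> y x ^+ 2 by exact: cvg_mul.
have gl x : g x t @[t --> F] --> l x.
  rewrite /g /l; case: eqP => [_|_]; first exact: cvg_mul (cvg_cst _) (u2 x).
  case: eqP => [yx|_]; last exact: cvg_mul (cvg_cst _) (u2 x).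
  rewrite yx expr0n mulr0 -(mulr0 (- z x)) -[X in _ * X]yx.
  by apply: cvg_mul (uy x); apply: cvgN.
have wC : \forall t \near F, forall x, y x != 0 -> w x t <= C.
  apply: filter_forall => x; have [_|yx] := eqVneq (y x) 0.
    by near=> t.
  near=> t => _; near: t; exact: cvgr_le (wl x yx) _ (zC x).
have gsum : \forall t \near F, \sum_x g x t <= 0.
  near=> t.
  have : \sum_x u x t ^+ 2 <= \sum_x s x t * u x t ^+ 2 by near: t.
  rewrite -subr_ge0 -sumrB => smin'.
  rewrite -oppr_ge0 -sumrN; apply: le_trans smin' _.
  apply: ler_sum => x _.
  have [s0 sm] := sw x t; have := w0 x t => wx0.
  have uu0 := sqr_ge0 (u x t).
  rewrite /g; case: eqP => [->|/eqP xx0].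
    have : s x0 t <= 2^-1.
      rewrite -(@ler_pXn2r _ m.+1) ?nnegrE ?invr_ge0 //; last by case: (sw x0 t).
      have [_ ->] := sw x0 t; near: t.
      have := wl x0 yx0; rewrite zx0 mul0r => wx00.
      by apply: (cvgr_le _ wx00); rewrite exprn_gt0 // invr_gt0.
    by move=> H; have := ler_wpM2r (sqr_ge0 (u x0 t)) H; lra.
  case: eqP => [yx|/eqP yx].
    have : s x t <= 1 + w x t.
      have [s1|s1] := leP (s x t) 1; first by rewrite ler_wpDr // ltW.
      apply: (@le_trans _ _ (w x t)); last by rewrite lerDr.
      by rewrite -sm ler_eXnr // ltW.
    by move=> H; have := ler_wpM2r uu0 H; lra.
  have : s x t <= 1 + d.
    rewrite -(@ler_pXn2r _ m.+1) ?nnegrE ?addr_ge0 ?(ltW d0) // sm.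
    by apply: le_trans Cm; move: (x) yx; near: t.
  by move=> H; have := ler_wpM2r uu0 H; lra.
have := cvgr_to_le (cvg_fsum (fun x _ => gl x)) gsum.
rewrite (bigD1 x0) //= /l eqxx.
rewrite (eq_bigr (fun x => - d * y x ^+ 2)) => [|x /negPf ->] //.
rewrite -mulr_sumr => /(_ _ _) H.
have : \sum_(x | x != x0) y x ^+ 2 <= S.
  by rewrite /S [leRHS](bigD1 x0) //= lerDr sqr_ge0.
have dS : d * S = 4^-1 * y x0 ^+ 2 by rewrite /d; field; lra.
move/(ler_wpM2l (ltW d0)); rewrite dS; lra.
Unshelve. all: end_near. Qed.

(** Where [z] is nonzero the inverse weight is [u / (w * u)], a quotient of convergent functions.
    Where [z] vanishes so does [y], whatever the behaviour of [w]. *)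
Lemma scaling_inverse_cvg (R : realType) (T : Type) (F : set_system T)
    {FF : ProperFilter F} (w u : T -> R) (y z : R) :
  (forall t, 0 < w t) -> u t @[t --> F] --> y ->
  w t * u t @[t --> F] --> z -> (y != 0 -> z != 0) ->
  (w t)^-1 * z @[t --> F] --> y.
Proof.
move=> w0 uy wuz yz; have [z0|z0] := eqVneq z 0.
  have -> : y = 0 by apply/eqP/negPn/negP => /yz; rewrite z0 eqxx.
  rewrite z0; under eq_fun do rewrite mulr0.
  exact: cvg_cst.
have : u t * (w t * u t)^-1 * z @[t --> F] --> y.
  rewrite -[y in X in _ --> X](mulfVK z0).
  by apply: cvg_mul; [apply: cvg_mul (cvg_inv _ _)|exact: cvg_cst].
apply: cvg_trans; apply: near_eq_cvg.
have nwu : \forall t \near F, w t * u t != 0 by exact: (cvgr_neq0 _ wuz z0).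
near=> t; have : w t * u t != 0 by near: t.
rewrite mulf_eq0 negb_or => /andP[w1 u1].
by rewrite invfM mulrCA mulfV // mulr1.
Unshelve. all: by end_near. Qed.

(** * Orbit closures and minimal vectors *)

(** Used with sets of group elements that are within [e] of some goal; the ultrafilter takes the
    place of repeated extraction of subsequences. *)
Lemma ultrafilter_of_base (R : realFieldType) (T : Type) (B : R -> set T) :
  (forall e, 0 < e -> B e !=set0) ->
  (forall e1 e2, e1 <= e2 -> B e1 `<=` B e2) ->
  exists F : set_system T, UltraFilter F /\ forall e, 0 < e -> F (B e).
Proof.
move=> B0 Bmono.
have FB : ProperFilter (filter_from [set e : R | 0 < e] B).
  apply: filter_from_proper; last exact: B0.
  apply: filter_from_filter; first by exists 1 => /=.
  move=> e1 e2 /= e10 e20; exists (Num.min e1 e2); first by rewrite /= lt_min e10.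
  by move=> t Bt; split; apply: Bmono Bt; rewrite ge_min lexx ?orbT.
have [F [FU BF]] := ultraFilterLemma FB.
by exists F; split=> // e e0; apply: BF; exists e.
Qed.

Section Closure.
Variables (R : realType) (n q k : nat).
Implicit Types (A B M : 'M[R]_n) (X Y Z : compvec R n k).
Local Notation eta := (Defs.eta R n q).

Lemma compvecB X Y x : (X - Y) x = X x - Y x.
Proof. by rewrite !ffunE. Qed.

Lemma sqnorm_ge0 X : 0 <= sqnorm X.
Proof. by apply: sumr_ge0 => x _; exact: sqr_ge0. Qed.

Lemma cnorm_lt X e : 0 < e -> (cnorm X < e) = (sqnorm X < e ^+ 2).
Proof.
move=> e0; rewrite /cnorm -/(sqnorm X) -(@ltr_pXn2r _ 2) ?nnegrE ?sqrtr_ge0 ?ltW //.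
by rewrite sqr_sqrtr // sqnorm_ge0.
Qed.

Lemma sqr_le_sqnorm X x : X x ^+ 2 <= sqnorm X.
Proof.
by rewrite /sqnorm (bigD1 x) //= lerDl; apply: sumr_ge0 => y _; exact: sqr_ge0.
Qed.

Lemma cvg_sqnorm (T : Type) (F : set_system T) {FF : Filter F}
    (f : T -> compvec R n k) X :
  (forall x, f t x @[t --> F] --> X x) -> sqnorm (f t) @[t --> F] --> sqnorm X.
Proof. by move=> fX; apply: cvg_fsum => x _; apply: cvg_mul. Qed.

Lemma cvg_act (T : Type) (F : set_system T) {FF : Filter F}
    (A : T -> 'M[R]_n) (B : 'M[R]_n) (f : T -> compvec R n k) X :
  (forall i j, A t i j @[t --> F] --> B i j) ->
  (forall x, f t x @[t --> F] --> X x) ->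
  forall x, act (A t) (f t) x @[t --> F] --> act B X x.
Proof.
move=> AB fX x; rewrite ffunE; under eq_fun do rewrite ffunE.
by apply: cvg_fsum => b _; apply: cvg_mul => //; apply: cvg_fprod.
Qed.

Lemma orbit_closure_ultra X Z : in_orbit_closure q X Z ->
  exists F : set_system 'M[R]_n, [/\ UltraFilter F,
    \forall M \near F, in_G q M &
    forall x, act M X x @[M --> F] --> Z x].
Proof.
move=> XZ.
have [|e1 e2 e12 M [GM Me]|F [FU FB]] := @ultrafilter_of_base R _
  (fun e => [set M | in_G q M /\ cnorm (act M X - Z) < e]).
- by move=> e e0; have [M [GM Me]] := XZ e e0; exists M.
- by split=> //; exact: lt_le_trans e12.
exists F; split=> //; first by apply: filterS (FB 1 _) => // M [].
move=> x; apply/cvgrPdist_lt => e e0.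
apply: filterS (FB e e0) => M [_]; rewrite cnorm_lt // => Me.
rewrite distrC -(@ltr_pXn2r _ 2) ?nnegrE ?normr_ge0 ?(ltW e0) //.
rewrite real_normK ?num_real //; apply: le_lt_trans Me.
by rewrite -compvecB; exact: sqr_le_sqnorm.
Qed.

Lemma cvg_orbit_closure (T : Type) (F : set_system T) {FF : ProperFilter F}
    (A : T -> 'M[R]_n) X Z :
  (\forall t \near F, in_G q (A t)) ->
  (forall x, act (A t) X x @[t --> F] --> Z x) -> in_orbit_closure q X Z.
Proof.
move=> GA AZ e e0.
have sq0 : sqnorm (act (A t) X - Z) @[t --> F] --> sqnorm (Z - Z).
  apply: cvg_sqnorm => x; rewrite compvecB; under eq_fun do rewrite compvecB.
  exact: cvg_sub (AZ x) (cvg_cst _).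
have s0 : sqnorm (Z - Z) < e ^+ 2.
  rewrite subrr /sqnorm big1 ?exprn_gt0 // => x _.
  by rewrite ffunE expr0n.
near F => t; exists (A t); rewrite cnorm_lt //; split; first by near: t.
near: t; exact: (cvgr_lt _ sq0).
Unshelve. all: by end_near. Qed.

Lemma orbit_closure_refl X : in_orbit_closure q X X.
Proof.
move=> e e0; exists 1%:M; split; first exact: in_G1.
by rewrite act1 cnorm_lt // subrr /sqnorm big1 ?exprn_gt0 // => x _; rewrite ffunE expr0n.
Qed.

Lemma orbit_closure_act A X Z : in_G q A -> in_orbit_closure q X Z ->
  in_orbit_closure q X (act A Z).
Proof.
move=> GA /orbit_closure_ultra[F [FU FG XZ]].
apply: (@cvg_orbit_closure _ F _ (fun M => M *m A)).
  by apply: filterS FG => M GM; exact: in_GM.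
move=> x; under eq_fun do rewrite -act_mul.
by apply: cvg_act => // i j; exact: cvg_cst.
Qed.

(** Along an ultrafilter of group elements whose norms approach the infimum, the bounded orbit
    points converge. Every translate of the limit is again a limit of orbit points, so its norm is
    not below the infimum. *)
Lemma minimal_vector_exists X :
  exists2 Y, in_orbit_closure q X Y &
    forall M, in_G q M -> sqnorm Y <= sqnorm (act M Y).
Proof.
pose E := [set sqnorm (act M X) | M in [set M | in_G q M]].
have E0 : E !=set0 by exists (sqnorm (act 1%:M X)), 1%:M => //=; exact: in_G1.
have hinf : has_inf E.
  by split=> //; exists 0 => _ [M _ <-]; exact: sqnorm_ge0.
have [|e1 e2 e12 M [GM Me]|F [FU FB]] := @ultrafilter_of_base R _
  (fun e => [set M | in_G q M /\ sqnorm (act M X) < inf E + e]).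
- by move=> e e0; have [_ [M GM <-] Me] := inf_adherent e0 hinf; exists M.
- by split=> //; apply: lt_le_trans Me _; rewrite lerD2l.
have FG : \forall M \near F, in_G q M by apply: filterS (FB 1 _) => // M [].
have lim x : exists l : R, act M X x @[M --> F] --> l.
  (* A number whose square is at most [b] has absolute value at most [1 + b]; here [b] is
     [inf E + 1]. *)
  apply: (@ultra_bounded_cvg _ _ _ _ (1 + (inf E + 1))) => //.
  apply: filterS (FB 1 ltr01) => M [_ /ltW].
  move=> /(le_trans (sqr_le_sqnorm _ x)) H.
  rewrite ler_norml; have := sqr_ge0 (act M X x - 1); have := sqr_ge0 (act M X x + 1).
  by nra.
pose Y : compvec R n k := [ffun x => projT1 (cid (lim x))].
have XY x : act M X x @[M --> F] --> Y x by rewrite ffunE; exact: (projT2 (cid (lim x))).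
exists Y; first exact: cvg_orbit_closure XY.
have sqY : sqnorm Y <= inf E.
  apply/ler_addgt0Pr => e e0; apply: (cvgr_to_le (cvg_sqnorm XY)).
  by apply: filterS (FB e e0) => M [_ /ltW].
move=> M GM; apply: (le_trans sqY).
have : sqnorm (act M (act N X)) @[N --> F] --> sqnorm (act M Y).
  by apply: cvg_sqnorm; apply: cvg_act => // i j; exact: cvg_cst.
move=> /cvgr_to_ge; apply; apply: filterS FG => N GN.
rewrite act_mul; apply: ge_inf; first by case: hinf.
by exists (N *m M) => //=; exact: in_GM.
Qed.
End Closure.

(** * Entrywise limits of matrices *)

Section MatrixLimits.
Variables (R : realType) (T : Type) (F : set_system T).
Context {FF : ProperFilter F}.

Definition mx_cvg m n (A : T -> 'M[R]_(m, n)) (B : 'M[R]_(m, n)) :=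
  forall i j, A t i j @[t --> F] --> B i j.

Lemma mx_cvg_cst m n (B : 'M[R]_(m, n)) : mx_cvg (fun=> B) B.
Proof. by move=> i j; exact: cvg_cst. Qed.

Lemma mx_cvgM m n p (A : T -> 'M[R]_(m, n)) (A' : T -> 'M[R]_(n, p)) B B' :
  mx_cvg A B -> mx_cvg A' B' -> mx_cvg (fun t => A t *m A' t) (B *m B').
Proof.
move=> AB AB' i j; rewrite mxE; under eq_fun do rewrite mxE.
by apply: cvg_fsum => l _; exact: cvg_mul.
Qed.

Lemma mx_cvg_tr m n (A : T -> 'M[R]_(m, n)) B :
  mx_cvg A B -> mx_cvg (fun t => (A t)^T) B^T.
Proof. by move=> AB i j; rewrite mxE; under eq_fun do rewrite mxE; exact: AB. Qed.

(** Carries the matrix equations defining G and the orthogonal group over to limits. *)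
Lemma mx_cvg_near_cst m n (A : T -> 'M[R]_(m, n)) (B C : 'M[R]_(m, n)) :
  mx_cvg A B -> (\forall t \near F, A t = C) -> B = C.
Proof.
move=> AB AC; apply/matrixP => i j.
have ACij : A t i j @[t --> F] --> C i j.
  apply: (cvg_trans (near_eq_cvg _) (cvg_cst (C i j))).
  by apply: filterS AC => t ->.
exact: (cvg_unique _ (AB i j) ACij).
Qed.
End MatrixLimits.

Lemma orthogonal_entry_le1 (R : realFieldType) n (P : 'M[R]_n) i j :
  P *m P^T = 1%:M -> `|P i j| <= 1.
Proof.
move=> /matrixP/(_ i i); rewrite !mxE eqxx (bigD1 j) //= mxE -expr2 => Pij.
rewrite -(@ler_pXn2r _ 2) ?nnegrE // expr1n real_normK ?num_real //.
rewrite -[leRHS]Pij lerDl; apply: sumr_ge0 => l _.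
by rewrite mxE -expr2 sqr_ge0.
Qed.

(** * Orbits in the closure accumulate at a minimal vector *)

Section MinimalVector.
Variables (R : realType) (n q k : nat).
Implicit Types (M : 'M[R]_n) (X Y Z : compvec R n k).
Local Notation eta := (Defs.eta R n q).

Lemma in_G_limit (T : Type) (F : set_system T) {FF : ProperFilter F}
    (A : T -> 'M[R]_n) B :
  mx_cvg F A B -> (\forall t \near F, in_G q (A t)) -> in_G q B.
Proof.
move=> AB; apply: mx_cvg_near_cst.
have eta_cvg : mx_cvg F (fun=> eta) eta by move=> i j; exact: cvg_cst.
exact: (mx_cvgM (mx_cvgM (mx_cvg_tr AB) eta_cvg) AB).
Qed.

Lemma orthogonal_limit (F : set_system 'M[R]_n) (A : 'M[R]_n -> 'M[R]_n) :
  UltraFilter F -> (\forall M \near F, A M *m (A M)^T = 1%:M) ->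
  exists2 B, mx_cvg F A B & B *m B^T = 1%:M.
Proof.
move=> FU AA.
have lim i j : exists l : R, A M i j @[M --> F] --> l.
  apply: (@ultra_bounded_cvg _ _ _ _ 1) => //; apply: filterS AA => M.
  exact: orthogonal_entry_le1.
pose B := \matrix_(i, j) projT1 (cid (lim i j)).
have AB : mx_cvg F A B by move=> i j; rewrite mxE; exact: (projT2 (cid (lim i j))).
by exists B => //; apply: mx_cvg_near_cst AA; exact: mx_cvgM (mx_cvg_tr AB).
Qed.

Lemma weightX (d : 'rV[R]_n) m (x : comp_index n k) :
  weight d x ^+ m = weight (\row_i (d 0 i ^+ m)) x.
Proof. by rewrite /weight -prodrXl; apply: eq_bigr => j _; rewrite mxE. Qed.

Lemma weightV (d : 'rV[R]_n) (x : comp_index n k) :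
  weight (\row_i (d 0 i)^-1) x = (weight d x)^-1.
Proof. by rewrite /weight -prodfV; apply: eq_bigr => j _; rewrite mxE. Qed.

Lemma minimal_in_orbit_closure Y Z :
  (forall M, in_G q M -> sqnorm Y <= sqnorm (act M Y)) ->
  in_orbit_closure q Y Z -> in_orbit_closure q Z Y.
Proof.
move=> Ymin /orbit_closure_ultra[F [FU FG YZ]].
(* [choice] needs a decomposition for every matrix; outside G the default diagonal is constantly 1,
   so that all weights are positive. *)
have svd M : exists PQd : 'M[R]_n * 'M[R]_n * 'rV[R]_n,
    (forall i, 0 < PQd.2 0 i) /\ (in_G q M ->
    [/\ PQd.1.1 *m PQd.1.1^T = 1%:M, PQd.1.2 *m PQd.1.2^T = 1%:M,
      M = PQd.1.1 *m diag_mx PQd.2 *m PQd.1.2 &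
      forall i j, (PQd.1.1^T *m eta *m PQd.1.1) i j != 0 ->
        PQd.2 0 i * PQd.2 0 j = 1]).
  have [/in_G_svd [P [Q [d [? ? ? ? ?]]]]|nG] := pselect (in_G q M).
    by exists (P, Q, d).
  by exists (0, 0, const_mx 1); split=> // i; rewrite mxE.
have {svd}[f fP] := choice svd.
pose P M := (f M).1.1; pose Q M := (f M).1.2; pose d M := (f M).2.
have d0 M i : 0 < d M 0 i by have [] := fP M.
have PP : \forall M \near F, P M *m (P M)^T = 1%:M.
  by apply: filterS FG => M GM; have [_ /(_ GM)[]] := fP M.
have QQ : \forall M \near F, Q M *m (Q M)^T = 1%:M.
  by apply: filterS FG => M GM; have [_ /(_ GM)[]] := fP M.
have ME : \forall M \near F, M = P M *m diag_mx (d M) *m Q M.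
  by apply: filterS FG => M GM; have [_ /(_ GM)[]] := fP M.
have Pd : \forall M \near F, forall i j,
    ((P M)^T *m eta *m P M) i j != 0 -> d M 0 i * d M 0 j = 1.
  by apply: filterS FG => M GM; have [_ /(_ GM)[]] := fP M.
have [P0 PP0 P01] := orthogonal_limit FU PP.
have [Q0 QQ0 Q01] := orthogonal_limit FU QQ.
pose w (x : comp_index n k) M := weight (d M) x : R.
pose u x M := act (P M) Y x.
pose y x := act P0 Y x.
pose z x := act Q0^T Z x.
have w0 x M : 0 < w x M by exact: weight_gt0.
have uy x : u x M @[M --> F] --> y x.
  by apply: cvg_act => // x'; exact: cvg_cst.
(* Removing [Q M] from [M] leaves the diagonal part applied to [act (P M) Y]. *)
have wuz x : w x M * u x M @[M --> F] --> z x.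
  have : act (Q M)^T (act M Y) x @[M --> F] --> z x.
    by apply: cvg_act => //; exact: mx_cvg_tr.
  apply: cvg_trans; apply: near_eq_cvg; near=> M.
  have ME' : M = P M *m diag_mx (d M) *m Q M by near: M.
  have -> : act M Y = act (Q M) (act (diag_mx (d M)) (act (P M) Y)).
    by rewrite {1}ME' !act_mul mulmxA.
  have QM : Q M *m (Q M)^T = 1%:M by near: M.
  by rewrite (act_mul (Q M)^T) QM act1 act_diag.
have hmin m : exists2 s : comp_index n k -> 'M[R]_n -> R,
    forall x M, 0 <= s x M /\ s x M ^+ m.+1 = w x M &
    \forall M \near F, \sum_x u x M ^+ 2 <= \sum_x s x M * u x M ^+ 2.
  (* Minimality is tested on P D^(1/(2(m+1))) P^T, which lies in G. *)
  pose r : R := (2 * m.+1)%:R^-1.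
  pose d' M : 'rV[R]_n := \row_i (d M 0 i `^ r).
  exists (fun x M => weight (d' M) x ^+ 2) => [x M|].
    split; first exact: sqr_ge0.
    rewrite -exprM weightX; congr weight; apply/rowP => i; rewrite !mxE.
    by rewrite -powR_mulrn ?powR_ge0 // -powRrM mulVf ?pnatr_eq0 // powRr1 // ltW.
  near=> M.
  have PM : P M *m (P M)^T = 1%:M by near: M.
  have GM : in_G q (P M *m diag_mx (d' M) *m (P M)^T).
    apply: in_G_conj_diag => // i j Pij; rewrite !mxE -powRM ?ltW //.
    suff -> : d M 0 i * d M 0 j = 1 by rewrite powR1.
    by move: i j Pij; near: M.
  (* Dropping the outer isometry and writing the norm of [Y] as that of [act (P M) Y] turns
     minimality into an inequality between weighted sums of squares of [u]. *)
  have := Ymin _ GM; rewrite -!act_mul (@sqnorm_act _ _ _ (P M)^T).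
    rewrite -(@sqnorm_act _ _ _ (P M) Y) // => /le_trans; apply.
    rewrite le_eqVlt; apply/orP; left; apply/eqP; apply: eq_bigr => x _.
    by rewrite act_diag exprMn.
  by rewrite trmxK; exact: mulmx1C.
have yz x : y x != 0 -> z x != 0.
  exact: (scaling_limit_neq0 w0 uy wuz hmin).
pose d1 M : 'rV[R]_n := \row_i (d M 0 i)^-1.
apply: (@cvg_orbit_closure _ _ _ _ _ F _
  (fun M => Q0^T *m diag_mx (d1 M) *m P0^T)).
  (* [P M *m Q M] is the product of the inverse of the positive part of [M] with [M], so it lies in
     G, and the limit does too. *)
  have GPQ : in_G q (P0 *m Q0).
    apply: (in_G_limit (mx_cvgM PP0 QQ0)); near=> M.
    have PM : P M *m (P M)^T = 1%:M by near: M.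
    have GPd : in_G q (P M *m diag_mx (d1 M) *m (P M)^T).
      apply: in_G_conj_diag => // i j Pij; rewrite !mxE -invfM.
      suff -> : d M 0 i * d M 0 j = 1 by rewrite invr1.
      by move: i j Pij; near: M.
    have -> : P M *m Q M = P M *m diag_mx (d1 M) *m (P M)^T *m M.
      have ME' : M = P M *m diag_mx (d M) *m Q M by near: M.
      rewrite [X in _ = _ *m X]ME'.
      rewrite !mulmxA -(mulmxA _ (P M)^T (P M)) (mulmx1C PM) mulmx1.
      rewrite -(mulmxA _ (diag_mx (d1 M))).
      suff -> : diag_mx (d1 M) *m diag_mx (d M) = 1%:M by rewrite mulmx1.
      apply/matrixP => i j; rewrite mul_mx_diag !mxE; case: eqP => [->|_].
        by rewrite !mulr1n mulVf // gt_eqF.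
      by rewrite !mulr0n mul0r.
    by apply: in_GM => //; near: M.
  near=> M.
  have -> : Q0^T *m diag_mx (d1 M) *m P0^T =
      (P0 *m Q0)^T *m (P0 *m diag_mx (d1 M) *m P0^T).
    by rewrite trmx_mul !mulmxA -(mulmxA _ P0^T P0) (mulmx1C P01) mulmx1.
  apply: in_GM; first exact: in_G_tr.
  (* A nonzero entry of P0^T eta P0 is eventually nonzero in P^T eta P. *)
  apply: in_G_conj_diag => // i j Pij.
  rewrite !mxE -invfM; suff -> : d M 0 i * d M 0 j = 1 by rewrite invr1.
  move: i j Pij; near: M.
  apply: filter_forall => i; apply: filter_forall => j.
  have [_|Pij] := eqVneq ((P0^T *m eta *m P0) i j) 0; first by near=> M.
  have eta_cvg : mx_cvg F (fun=> eta) eta by move=> i' j'; exact: cvg_cst.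
  have PetaP : mx_cvg F (fun M => (P M)^T *m eta *m P M) (P0^T *m eta *m P0).
    exact: (mx_cvgM (mx_cvgM (mx_cvg_tr PP0) eta_cvg) PP0).
  have PMij : \forall M \near F, ((P M)^T *m eta *m P M) i j != 0.
    exact: (cvgr_neq0 _ (PetaP i j) Pij).
  by apply: filterS2 Pd PMij => M PdM PMij _; exact: PdM.
(* After cancelling [P0], it remains to see that the inverse weights times [z] converge to [y] in
   each coordinate. *)
move=> x; under eq_fun do rewrite -!act_mul.
rewrite -[Y]act1 -P01 -act_mul.
apply: cvg_act; first exact: mx_cvg_cst.
move=> x'; under eq_fun do rewrite act_diag weightV.
exact: scaling_inverse_cvg (w0 x') (uy x') (wuz x') (yz x').
Unshelve. all: by end_near. Qed.
End MinimalVector.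

(** * Semialgebraic sets *)

Section LocallyConstant.
Variable T : topologicalType.
Implicit Types A B : set T.

(* Stable under Boolean operations, and applied with B the closure of A it gives
   a nonempty relatively open subset of that closure contained in A. *)
Definition somewhere_constant A := forall B, B !=set0 ->
  exists U, [/\ open U, U `&` B !=set0 & U `&` B `<=` A \/ U `&` B `<=` ~` A].

Lemma somewhere_constant_iff A A' : (forall t, A t <-> A' t) ->
  somewhere_constant A -> somewhere_constant A'.
Proof. by move=> AA'; rewrite (_ : A' = A) //; apply/seteqP; split=> t /AA'. Qed.

Lemma somewhere_constantC A : somewhere_constant A -> somewhere_constant (~` A).
Proof.
move=> hA B /hA[U [oU UB [UA|UA]]]; exists U; split=> //; last by left.
by right; rewrite setCK.
Qed.

(** If the first open set [U] lands inside [A], the second property is applied to [U] intersected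
    with [B], so that both hold on a common open piece. *)
Lemma somewhere_constantI A A' : somewhere_constant A ->
  somewhere_constant A' -> somewhere_constant (A `&` A').
Proof.
move=> hA hA' B B0; have [U [oU UB [UA|UA]]] := hA B B0; last first.
  by exists U; split=> //; right => t /UA nA [].
have [U' [oU' UB' UA']] := hA' _ UB.
exists (U' `&` U); split; [exact: openI|by rewrite -setIA|].
case: UA' => UA'; [left|right] => t [[U't Ut] Bt].
  by split; [exact: UA|exact: UA'].
by move=> [_ A't]; apply: (UA' t).
Qed.

Lemma somewhere_constantU A A' : somewhere_constant A ->
  somewhere_constant A' -> somewhere_constant (A `|` A').
Proof.
move=> hA hA'; rewrite -[A `|` A']setCK setCU.
by apply/somewhere_constantC/somewhere_constantI; exact: somewhere_constantC.
Qed.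

Lemma somewhere_constant_open A : open A -> somewhere_constant A.
Proof.
move=> oA B B0; have [AB|AB] := pselect (A `&` B !=set0).
  by exists A; split=> //; left => t [].
exists setT; split; [exact: openT|by rewrite setTI|right].
by move=> t [_ Bt] At; apply: AB; exists t.
Qed.
End LocallyConstant.

(** * Sets defined by quantifier-free formulas *)

Section Formulas.
Variables (R : realType) (T : topologicalType) (env : T -> seq R).
Hypothesis env_cont : forall i, continuous (fun t => (env t)`_i).

(** [rterm] excludes inverses, so the term is a polynomial in the continuous environment. *)
Lemma continuous_eval (u : GRing.term R) : GRing.rterm u ->
  continuous (fun t => GRing.eval (env t) u).
Proof.
elim: u => //=.
- by move=> c _ t; exact: cvg_cst.
- by move=> c _ t; exact: cvg_cst.
- by move=> u IHu v IHv /andP[/IHu uc /IHv vc] t; exact: (cvgD (uc t) (vc t)).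
- by move=> u IHu /IHu uc t; exact: (cvgN (uc t)).
- by move=> u IHu m /IHu uc t; exact: (cvgMn (uc t)).
- by move=> u IHu v IHv /andP[/IHu uc /IHv vc] t; exact: (cvgM (uc t) (vc t)).
- move=> u IHu m /IHu uc t.
  exact: (continuous_comp (uc t) (@exprn_continuous _ m _)).
Qed.

Lemma somewhere_constant_lt (u v : GRing.term R) :
  GRing.rterm u -> GRing.rterm v ->
  somewhere_constant [set t | GRing.eval (env t) u < GRing.eval (env t) v].
Proof.
move=> ru rv; apply: somewhere_constant_open.
have -> : [set t | GRing.eval (env t) u < GRing.eval (env t) v] =
    (fun t => GRing.eval (env t) v - GRing.eval (env t) u) @^-1` [set x | 0 < x].
  by apply/seteqP; split => t /=; rewrite subr_gt0.
apply: open_comp; last exact: open_gt.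
have cu := continuous_eval ru; have cv := continuous_eval rv.
by move=> t _; exact: (cvgB (cv t) (cu t)).
Qed.

Lemma somewhere_constant_le (u v : GRing.term R) :
  GRing.rterm u -> GRing.rterm v ->
  somewhere_constant [set t | GRing.eval (env t) u <= GRing.eval (env t) v].
Proof.
move=> ru rv.
have -> : [set t | GRing.eval (env t) u <= GRing.eval (env t) v] =
    ~` [set t | GRing.eval (env t) v < GRing.eval (env t) u].
  by apply/seteqP; split => t /=; rewrite leNgt => /negP.
exact/somewhere_constantC/somewhere_constant_lt.
Qed.

Lemma somewhere_constant_qf (f : ord.formula R) :
  ord.qf_form f -> ord.rformula f ->
  somewhere_constant [set t | ord.qf_eval (env t) f].
Proof.
elim: f => //=.
- move=> [] _ _.
    by apply: somewhere_constant_iff (somewhere_constant_open (@openT T)).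
  by apply: somewhere_constant_iff (somewhere_constant_open (@open0 T)).
- move=> u v _ /andP[ru rv].
  apply: somewhere_constant_iff (somewhere_constantI
    (somewhere_constant_le ru rv) (somewhere_constant_le rv ru)) => t /=.
  by rewrite eq_le; split => [[-> ->]|/andP].
- by move=> u v _ /andP[]; exact: somewhere_constant_lt.
- by move=> u v _ /andP[]; exact: somewhere_constant_le.
- move=> f IHf g IHg /andP[/IHf {}IHf /IHg {}IHg] /andP[/IHf {}IHf /IHg {}IHg].
  by apply: somewhere_constant_iff (somewhere_constantI IHf IHg) => t; split=> /andP.
- move=> f IHf g IHg /andP[/IHf {}IHf /IHg {}IHg] /andP[/IHf {}IHf /IHg {}IHg].
  by apply: somewhere_constant_iff (somewhere_constantU IHf IHg) => t; split=> /orP.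
- move=> f IHf g IHg /andP[/IHf {}IHf /IHg {}IHg] /andP[/IHf {}IHf /IHg {}IHg].
  apply: somewhere_constant_iff
    (somewhere_constantU (somewhere_constantC IHf) IHg) => t /=.
  by rewrite implybE; split => [[/negP ->//|->]|/orP[/negP|]]; [rewrite orbT|left|right].
- move=> f IHf /IHf {}IHf /IHf {}IHf.
  by apply: somewhere_constant_iff (somewhere_constantC IHf) => t; split=> /negP.
Qed.
End Formulas.

(** * Definability and quantifier elimination *)

Section Definable.
Variable R : rcfType.
Implicit Types (P Q : (nat -> R) -> Prop) (g h : (nat -> R) -> R).

Definition polyterm g := exists2 u : GRing.term R, GRing.rterm u &
  forall e, GRing.eval e u = g (nth 0 e).

(** Predicates are on total valuations rather than lists, so variables can be overridden freely;
    those beyond the end of an environment read as 0. *)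
Definition definable P := exists2 f : ord.formula R, ord.rformula f &
  forall e, ord.holds e f <-> P (nth 0 e).

Lemma polyterm_var i : polyterm (fun v => v i).
Proof. by exists (GRing.Var R i). Qed.

Lemma polyterm_cst c : polyterm (fun=> c).
Proof. by exists (GRing.Const c). Qed.

Lemma polytermD g h : polyterm g -> polyterm h -> polyterm (fun v => g v + h v).
Proof.
move=> [u ru uE] [w rw wE]; exists (GRing.Add u w) => /= [|e]; first by rewrite ru.
by rewrite uE wE.
Qed.

Lemma polytermM g h : polyterm g -> polyterm h -> polyterm (fun v => g v * h v).
Proof.
move=> [u ru uE] [w rw wE]; exists (GRing.Mul u w) => /= [|e]; first by rewrite ru.
by rewrite uE wE.
Qed.

Lemma polyterm_sum (I : finType) (f : I -> (nat -> R) -> R) :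
  (forall i, polyterm (f i)) -> polyterm (fun v => \sum_i f i v).
Proof.
move=> pf; elim: (index_enum I) => [|i r IH].
  under eq_fun do rewrite big_nil; exact: polyterm_cst.
by under eq_fun do rewrite big_cons; exact: polytermD.
Qed.

Lemma polyterm_prod (I : finType) (f : I -> (nat -> R) -> R) :
  (forall i, polyterm (f i)) -> polyterm (fun v => \prod_i f i v).
Proof.
move=> pf; elim: (index_enum I) => [|i r IH].
  under eq_fun do rewrite big_nil; exact: polyterm_cst.
by under eq_fun do rewrite big_cons; exact: polytermM.
Qed.

Lemma definable_iff P Q : definable P -> (forall v, P v <-> Q v) -> definable Q.
Proof.
by move=> [f rf fP] PQ; exists f => // e; apply: iff_trans (PQ _); exact: fP.
Qed.

Lemma definable_eq g h : polyterm g -> polyterm h -> definable (fun v => g v = h v).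
Proof.
move=> [u ru uE] [w rw wE]; exists (ord.Equal u w) => /= [|e]; first by rewrite ru.
by rewrite uE wE.
Qed.

Lemma definable_and P Q : definable P -> definable Q -> definable (fun v => P v /\ Q v).
Proof.
move=> [f rf fP] [f' rf' fQ]; exists (ord.And f f') => /= [|e]; first by rewrite rf.
by rewrite fP fQ.
Qed.

Lemma definable_all (I : finType) (P : I -> (nat -> R) -> Prop) :
  (forall i, definable (P i)) -> definable (fun v => forall i, P i v).
Proof.
move=> dP.
suff: forall s : seq I, definable (fun v => forall i, i \in s -> P i v).
  move=> /(_ (enum I))/definable_iff; apply => v; split => H i //.
  by apply: H; rewrite mem_enum.
elim=> [|i s IHs]; first by exists (ord.Bool true) => //= e; split.
apply: (definable_iff (definable_and (dP i) IHs)) => v; split.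
  by move=> [Pi Ps] j; rewrite inE => /predU1P[->//|/Ps].
by move=> H; split=> [|j js]; apply: H; rewrite inE ?eqxx // js orbT.
Qed.

Lemma definable_ex i P : definable P ->
  definable (fun v => exists x, P (fun j => if j == i then x else v j)).
Proof.
move=> [f rf fP]; exists (ord.Exists i f) => // e /=.
by split => -[x Px]; exists x; move: Px; rewrite fP;
  congr P; apply/funext => j; rewrite nth_set_nth.
Qed.

(** Induction on the length of the block, the variable [m + p] being quantified innermost. Only the
    values of [w] on the block matter. *)
Lemma definable_exn m p P : definable P -> definable (fun v =>
  exists w : nat -> R, P (fun j => if (m <= j < m + p)%N then w j else v j)).
Proof.
elim: p P => [|p IHp] P dP.
  apply: (definable_iff dP) => v; split=> [Pv|[w]].
    exists v; move: Pv; congr P; apply/funext => j; by case: ifP.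
  by congr P; apply/funext => j; rewrite addn0 ltnNge; case: leqP.
apply: (definable_iff (IHp _ (definable_ex (m + p)%N dP))) => v; split.
  move=> [w [x Pw]]; exists (fun j => if j == (m + p)%N then x else w j).
  move: Pw; congr P; apply/funext => j; case: eqP => [->|/eqP jmp].
    by rewrite leq_addr addnS ltnSn.
  by rewrite addnS ltnS (leq_eqVlt j) (negPf jmp).
move=> [w Pw]; exists w, (w (m + p)%N).
move: Pw; congr P; apply/funext => j; case: eqP => [->|/eqP jmp].
  by rewrite leq_addr addnS ltnSn.
by rewrite addnS ltnS (leq_eqVlt j) (negPf jmp).
Qed.

(** Tarski's quantifier elimination for real closed fields. *)
Lemma definable_qf P : definable P -> exists f : ord.formula R,
  [/\ ord.qf_form f, ord.rformula f & forall e, ord.qf_eval e f <-> P (nth 0 e)].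
Proof.
move=> [f rf fP]; exists (ord.quantifier_elim (@wproj R) f).
have /andP[-> ->] := ord.quantifier_elim_wf (@wf_QE_wproj R) rf.
split=> // e; apply: iff_trans (fP e).
have H := ord.quantifier_elim_rformP (@wf_QE_wproj R) (@valid_QE_wproj R) e rf.
by split => /H.
Qed.
End Definable.

(** * Minimal vectors have closed orbits *)

Section ClosedOrbit.
Variables (R : realType) (n q k : nat).
Implicit Types (M : 'M[R]_n) (X Y Z : compvec R n k).
Local Notation eta := (Defs.eta R n q).
Local Notation m := #|{: comp_index n k}|.

Definition vec_of (v : nat -> R) : compvec R n k := [ffun x => v (enum_rank x)].

(* Variables below m are the components of a vector, the following ones the
   entries of a matrix. *)
Definition mx_of (v : nat -> R) : 'M[R]_n :=
  \matrix_(i, j) v (m + enum_rank (i, j))%N.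

(** One block of quantifiers over the matrix entries, in front of polynomial equations in which the
    entries of [eta] and the components of [Y] are constants. *)
Lemma definable_orbit Y :
  definable (fun v => exists M, in_G q M /\ act M Y = vec_of v).
Proof.
pose P v := in_G q (mx_of v) /\ act (mx_of v) Y = vec_of v.
have dP : definable P.
  have pM i j : polyterm (fun v => mx_of v i j).
    by under eq_fun do rewrite mxE; exact: polyterm_var.
  apply: definable_and.
    apply: (@definable_iff _ (fun v => forall i j,
        ((mx_of v)^T *m eta *m mx_of v) i j = eta i j)).
      apply: definable_all => i; apply: definable_all => j; apply: definable_eq.
        under eq_fun do rewrite mxE; apply: polyterm_sum => l; apply: polytermM => //.
        under eq_fun do rewrite mxE; apply: polyterm_sum => l'; apply: polytermM.
          by under eq_fun do rewrite mxE.
        exact: polyterm_cst.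
      exact: polyterm_cst.
    by move=> v; split=> [vE|vE i j]; [apply/matrixP|rewrite vE].
  apply: (@definable_iff _ (fun v => forall x, act (mx_of v) Y x = vec_of v x)).
    apply: definable_all => x; apply: definable_eq; last first.
      by under eq_fun do rewrite ffunE; exact: polyterm_var.
    under eq_fun do rewrite ffunE; apply: polyterm_sum => b.
    by apply: polytermM; [exact: polyterm_prod|exact: polyterm_cst].
  by move=> v; split=> [vE|-> //]; apply/ffunP.
apply: (definable_iff (definable_exn m #|{: 'I_n * 'I_n}| dP)) => v.
have vecE w : vec_of (fun j =>
    if (m <= j < m + #|{: 'I_n * 'I_n}|)%N then w j else v j) = vec_of v.
  by apply/ffunP => x; rewrite !ffunE leqNgt ltn_ord.
split=> [[w [GM actM]]|[M [GM actM]]].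
  by rewrite vecE in actM; eexists; split; [exact: GM|].
(* The entries of [M] in enumeration order, shifted past the [m] vector components. *)
exists (fun j => nth 0 [seq M ij.1 ij.2 | ij <- enum {: 'I_n * 'I_n}] (j - m)).
set w := fun j : nat => _; suff mxw : mx_of w = M.
  by rewrite /P mxw; split=> //; rewrite vecE.
apply/matrixP => i j; rewrite mxE /w leq_addr ltn_add2l ltn_ord addKn.
by rewrite (nth_map (i, j)) ?nth_enum_rank // -cardE ltn_ord.
Qed.

(** Row vectors are the topological model of the component space; reading one as an environment
    links it to formulas. *)
Definition row_env (t : 'rV[R]_m) : seq R := [seq t 0 i | i <- enum 'I_m].

Lemma row_env_nth (t : 'rV[R]_m) (i : 'I_m) : (row_env t)`_i = t 0 i.
Proof. by rewrite (nth_map i) ?nth_ord_enum // size_enum_ord ltn_ord. Qed.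

Lemma row_env_continuous i : continuous (fun t => (row_env t)`_i).
Proof.
have [im|im] := ltnP i m.
  have -> : (fun t => (row_env t)`_i) = (fun t => t 0 (Ordinal im)).
    by apply/funext => t; exact: (row_env_nth t (Ordinal im)).
  exact: coord_continuous.
have -> : (fun t => (row_env t)`_i) = (fun=> 0).
  by apply/funext => t; rewrite nth_default // size_map size_enum_ord.
exact: cst_continuous.
Qed.

Lemma orbit_somewhere_constant Y : somewhere_constant
  [set t : 'rV[R]_m | exists M, in_G q M /\ act M Y = vec_of (nth 0 (row_env t))].
Proof.
have [f [qf rf fP]] := definable_qf (definable_orbit Y).
apply: somewhere_constant_iff (somewhere_constant_qf row_env_continuous qf rf).
by move=> t; exact: fP.
Qed.

Definition row_of X : 'rV[R]_m := \row_i X (enum_val i).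

Lemma row_ofK X : vec_of (nth 0 (row_env (row_of X))) = X.
Proof. by apply/ffunP => x; rewrite ffunE row_env_nth mxE enum_rankK. Qed.

Lemma vec_of_rowK (t : 'rV[R]_m) : row_of (vec_of (nth 0 (row_env t))) = t.
Proof.
by apply/rowP => i; rewrite mxE ffunE enum_valK row_env_nth.
Qed.

Lemma cvg_row_of (T : Type) (F : set_system T) {FF : Filter F}
    (f : T -> compvec R n k) X :
  (forall x, f t x @[t --> F] --> X x) -> row_of (f t) @[t --> F] --> row_of X.
Proof.
move=> fX; apply/cvg_ballP => e e0.
have fXe : \forall t \near F, forall x, ball (X x) e (f t x).
  by apply: filter_forall => x; move/cvg_ballP: (fX x); apply.
by apply: filterS fXe => t fXt; split=> // i j; rewrite !mxE.
Qed.

Lemma orbit_somewhere_open Y : exists2 U : set 'rV[R]_m, open U &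
  (exists M, in_G q M /\ U (row_of (act M Y))) /\
  (forall Z, in_orbit_closure q Y Z -> U (row_of Z) ->
    exists M, in_G q M /\ act M Y = Z).
Proof.
have [|U [oU [t0 [Ut0 Yt0]] HU]] := @orbit_somewhere_constant Y
    [set t | in_orbit_closure q Y (vec_of (nth 0 (row_env t)))].
  by exists (row_of Y); rewrite /= row_ofK; exact: orbit_closure_refl.
(* An open set that meets the closure meets the orbit itself, so the alternative in which [U] avoids
   the orbit is impossible. *)
have UY : exists M, in_G q M /\ U (row_of (act M Y)).
  have [F [FU FG YF]] := orbit_closure_ultra Yt0.
  have FUt : \forall M \near F, U (row_of (act M Y)).
    apply: (cvg_row_of YF); rewrite vec_of_rowK.
    exact: open_nbhs_nbhs.
  near F => M; exists M; split; first by near: M.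
  by near: M.
exists U => //; split=> // Z YZ UZ; case: HU => [/(_ (row_of Z))|HU].
  by rewrite /= row_ofK; apply.
have [M [GM UM]] := UY.
exfalso; apply: (HU (row_of (act M Y))); rewrite /= row_ofK.
  by split=> //; apply: orbit_closure_act => //; exact: orbit_closure_refl.
by exists M.
Unshelve. all: by end_near. Qed.

Lemma minimal_vector_characterised Y :
  (forall M, in_G q M -> sqnorm Y <= sqnorm (act M Y)) -> characterised q Y.
Proof.
move=> Ymin Z YZ.
have [U oU [[A [GA UA]] HU]] := orbit_somewhere_open Y.
have [F [FU FG ZF]] := orbit_closure_ultra (minimal_in_orbit_closure Ymin YZ).
(* [A] moves [Y] into [U], hence also the points of the orbit of [Z] close to [Y]; these lie in the
   closure of the orbit of [Y], and within [U] that means in the orbit. *)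
have ZA : \forall M \near F, U (row_of (act A (act M Z))).
  have : row_of (act A (act M Z)) @[M --> F] --> row_of (act A Y).
    by apply: cvg_row_of; apply: cvg_act => // i j; exact: cvg_cst.
  by apply; exact: open_nbhs_nbhs.
near F => M.
have GM : in_G q M by near: M.
have ZAM : U (row_of (act A (act M Z))) by near: M.
have [|N [GN NY]] := HU (act A (act M Z)) _ ZAM.
  by apply: orbit_closure_act => //; exact: orbit_closure_act.
rewrite act_mul in NY.
have [B BMA] : exists B, (M *m A) *m B = 1%:M.
  exists (eta *m (M *m A)^T *m eta); apply: mulmx1C.
  by apply: in_G_inv; exact: in_GM.
exists (N *m B); split.
  apply: in_GM => //; apply: (in_G_invmx _ (mulmx1C BMA)).
  exact: in_GM.
by rewrite -act_mul NY act_mul BMA act1.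
Unshelve. all: by end_near. Qed.

(** * Polynomial invariants on orbit closures *)

Lemma poly_fun_cvg (I : compvec R n k -> R) (T : Type) (F : set_system T)
    {FF : Filter F} (f : T -> compvec R n k) X :
  poly_fun I -> (forall x, f t x @[t --> F] --> X x) ->
  I (f t) @[t --> F] --> I X.
Proof.
move=> pI fX; elim: pI => [c|x|g h _ gX _ hX|g h _ gX _ hX].
- exact: cvg_cst.
- exact: fX.
- exact: cvgD gX hX.
- exact: cvgM gX hX.
Qed.

Lemma poly_invariant_orbit_closure (I : compvec R n k -> R) X Y :
  poly_invariant q I -> in_orbit_closure q X Y -> I Y = I X.
Proof.
move=> [pI invI] /orbit_closure_ultra[F [FU FG XF]].
have IX : I (act M X) @[M --> F] --> I X.
  apply: (cvg_trans (near_eq_cvg _) (cvg_cst (I X))).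
  by apply: filterS FG => M GM; rewrite invI.
exact: (cvg_unique _ (poly_fun_cvg pI XF) IX).
Qed.
End ClosedOrbit.

(* X0 : components of the curvature data in a fixed reference orthonormal
   frame at p; the components in any other orthonormal frame are act M X0
   with M in O(q, n-q). *)
Theorem theorem3 (R : realType) (n q k : nat) (hq : (q <= n)%N)
    (X0 : compvec R n k) :
  characterised q X0 \/
  (forall eps : R, 0 < eps ->
     exists M : 'M[R]_n, in_G q M /\
     exists Xt : compvec R n k,
       cnorm (act M X0 - Xt) < eps /\
       characterised q Xt /\
       (forall I, poly_invariant q I -> I Xt = I (act M X0))).
Proof.
right=> eps eps0.
(* The same minimal vector serves for every [eps]; only the frame change [M] depends on [eps]. *)
have [Y XY Ymin] := minimal_vector_exists q X0.
have [M [GM MY]] := XY eps eps0.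
exists M; split=> //; exists Y; split=> //; split.
  exact: minimal_vector_characterised.
by move=> I inv; rewrite (poly_invariant_orbit_closure inv XY) (proj2 inv).
Qed.
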